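(* Let $T$ be a finite tree and $S\subsetneq T$ a subtree. If $w$ is a neighbour of $S$, then $$\mu_T(S+w)=\mu_T(S)+\frac{R_T(w;S)}{N_T(w;S)\,\bigl(1+N_T(w;S)\bigr)}.$$
   Context: A subtree of a tree $T$ is a nonempty connected subgraph. For a subtree $S\subseteq T$, let $N_T(S)$ be the number of subtrees of $T$ containing $S$ and $R_T(S)$ the sum of the orders (numbers of vertices) of all subtrees of $T$ containing $S$. The local mean at $S$ is $\mu_T(S)=R_T(S)/N_T(S)$. A neighbour of $S$ is a vertex $w$ of $T$ outside $S$ that is adjacent to some vertex of $S$; $S+w$ is then the subtree on the vertices of $S$ together with $w$. For a vertex $w$ of $T$ outside $S$, let $(S,w)_T$ be the smallest subtree of $T$ containing $S$ and $w$; $N_T(w;S)$ is the number of subtrees $R$ of $T$ that contain $w$ and satisfy $R\cap (S,w)_T=\{w\}$ (i.e. subtrees rooted at $w$ growing away from $S$), and $R_T(w;S)$ is the sum of the orders of all such subtrees. *)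

(* Defs.v *)
From mathcomp Require Import all_boot all_order all_algebra.

Set Implicit Arguments.
Unset Strict Implicit.
Unset Printing Implicit Defensive.

Import GRing.Theory.

Definition is_tree (V : finType) (e : rel V) : Prop :=
  [/\ symmetric e, irreflexive e, 0 < #|V|,
      forall x y : V, connect e x y
    & forall c : seq V, ucycle e c -> size c <= 2].

Definition edges (V : finType) (e : rel V) : {set {set V}} :=
  [set f | [exists x, exists y, e x y && (f == [set x; y])]].

(* A vertex set together with a set of edges, seen as unordered pairs. *)
Definition subgraph (V : finType) : finType :=
  ({set V} * {set {set V}})%type.

Definition vset (V : finType) (H : subgraph V) : {set V} := H.1.
Definition eset (V : finType) (H : subgraph V) : {set {set V}} := H.2.

Definition whole (V : finType) (e : rel V) : subgraph V := (setT, edges e).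

Definition single (V : finType) (w : V) : subgraph V := ([set w], set0).

Definition contained (V : finType) (H K : subgraph V) : bool :=
  (vset H \subset vset K) && (eset H \subset eset K).

Definition capg (V : finType) (H K : subgraph V) : subgraph V :=
  (vset H :&: vset K, eset H :&: eset K).

Definition is_subgraph (V : finType) (e : rel V) (H : subgraph V) : bool :=
  contained H (whole e) && [forall f in eset H, f \subset vset H].

Definition connected (V : finType) (H : subgraph V) : bool :=
  [forall x in vset H, forall y in vset H,
     connect [rel u v | [set u; v] \in eset H] x y].

Definition is_subtree (V : finType) (e : rel V) (H : subgraph V) : bool :=
  [&& is_subgraph e H, vset H != set0 & connected H].

Definition subgraph_order (V : finType) (H : subgraph V) : nat := #|vset H|.

Definition N (V : finType) (e : rel V) (S : subgraph V) : nat :=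
  #|[set H : subgraph V | is_subtree e H & contained S H]|.

Definition R (V : finType) (e : rel V) (S : subgraph V) : nat :=
  \sum_(H : subgraph V | is_subtree e H && contained S H) subgraph_order H.

Definition mu (V : finType) (e : rel V) (S : subgraph V) : rat :=
  ((R e S)%:R / (N e S)%:R)%R.

Definition is_neighbour (V : finType) (e : rel V) (S : subgraph V) (w : V)
    : bool :=
  (w \notin vset S) && [exists x in vset S, e x w].

Definition add_vertex (V : finType) (e : rel V) (S : subgraph V) (w : V)
    : subgraph V :=
  (w |: vset S, eset S :|: [set [set x; w] | x in vset S & e x w]).

Definition is_smallest_subtree (V : finType) (e : rel V) (S : subgraph V)
    (w : V) (J : subgraph V) : bool :=
  [&& is_subtree e J, contained S J, w \in vset J
    & [forall K : subgraph V,
         [&& is_subtree e K, contained S K & w \in vset K] ==> contained J K]].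

(* The smallest subtree containing S and w; the default is irrelevant, since in a tree it always
   exists (and is unique). *)
Definition hull (V : finType) (e : rel V) (S : subgraph V) (w : V)
    : subgraph V :=
  odflt (whole e) [pick J | is_smallest_subtree e S w J].

Definition is_branch (V : finType) (e : rel V) (S : subgraph V) (w : V)
    (B : subgraph V) : bool :=
  [&& is_subtree e B, w \in vset B & capg B (hull e S w) == single w].

Definition N_at (V : finType) (e : rel V) (w : V) (S : subgraph V) : nat :=
  #|[set B : subgraph V | is_branch e S w B]|.

Definition R_at (V : finType) (e : rel V) (w : V) (S : subgraph V) : nat :=
  \sum_(B : subgraph V | is_branch e S w B) subgraph_order B.

(* Main.v *)
Require Import Defs.
From mathcomp Require Import all_boot all_order all_algebra.
From mathcomp Require Import ring.

Set Implicit Arguments.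
Unset Strict Implicit.
Unset Printing Implicit Defensive.

Import GRing.Theory Num.Theory.

(** In a tree every edge is a bridge. If [x] is the vertex of [S] adjacent to
    [w], deleting the edge [xw] separates [V] into the side of [x], which
    contains [S], and the side of [w]. A subtree [H] containing [S] and [w] must
    use the edge [xw] ([subtree_crossing]), and deleting that edge cuts [H] into
    a subtree [A] containing [S] and avoiding [w], and a subtree [B] containing
    [w] and avoiding [x]. Conversely any such [A] and [B] lie on opposite sides
    ([subtree_avoid]) and are joined by [xw] into a subtree [H]. So [H] and
    [(A, B)] determine each other ([glue_restrict], [restrict_glue]), the orders
    add up, and the possible [B] are exactly the branches at [w] growing away
    from [S] ([is_branchE]).

    Let [n] and [r] be the number and the total order of the possible [A], and
    [n'] and [r'] those of the branches. The subtrees containing [S + w] number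
    [n n'] and have total order [r n' + n r'] ([count_add_vertex],
    [order_add_vertex]). A subtree containing [S] either avoids [w] or contains
    [S + w], so those number [n + n n'] and have total order
    [r + r n' + n r']. Hence the local mean is [r/n + r'/n'] at [S + w] and
    [r/n + r'/(1 + n')] at [S], and the difference is [r'/(n' (1 + n'))]. *)

(** * Unordered pairs and connectivity *)

Lemma eq_set2 (T : finType) (u v x y : T) :
  [set u; v] = [set x; y] -> (u = x /\ v = y) \/ (u = y /\ v = x).
Proof.
move=> E.
have /set2P[ux|uy] : u \in [set x; y] by rewrite -E set21.
- have /set2P[vx|vy] : v \in [set x; y] by rewrite -E set22.
  + have /set2P[yu|yv] : y \in [set u; v] by rewrite E set22.
    * by left; rewrite ux vx yu ux.
    * by left; rewrite ux yv.
  + by left.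
- have /set2P[vx|vy] : v \in [set x; y] by rewrite -E set22.
  + by right.
  + have /set2P[xu|xv] : x \in [set u; v] by rewrite E set21.
    * by right; rewrite vy -uy xu.
    * by right; rewrite xv.
Qed.

Lemma connect_invariant (T : finType) (r : rel T) (P : pred T) (a : T) :
  (forall u v, r u v -> P u -> P v) -> P a -> forall v, connect r a v -> P v.
Proof.
move=> cl Pa v /connectP[p]; elim: p a Pa => [|b p IH] a Pa /=.
  by move=> _ ->.
by case/andP=> rab pb; apply: IH pb; apply: cl rab Pa.
Qed.

(** * Subgraphs and their edges *)

Definition adj (V : finType) (H : subgraph V) : rel V :=
  [rel u v | [set u; v] \in eset H].

Definition del_edge (V : finType) (e : rel V) (f : {set V}) : rel V :=
  [rel u v | e u v && ([set u; v] != f)].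

Definition is_bridge (V : finType) (e : rel V) (a b : V) : bool :=
  e a b && ~~ connect (del_edge e [set a; b]) a b.

Definition side (V : finType) (e : rel V) (a b : V) : {set V} :=
  [set v | connect (del_edge e [set a; b]) a v].

(** Edges are kept only if both ends are in [X]: restricting to one side of a
    bridge discards the bridge. *)
Definition restrict (V : finType) (X : {set V}) (H : subgraph V) : subgraph V :=
  (vset H :&: X, [set f in eset H | f \subset X]).

(** Inverse to the pair of restrictions to the two sides of the bridge [ab]. *)
Definition glue (V : finType) (a b : V) (A B : subgraph V) : subgraph V :=
  (vset A :|: vset B, [set a; b] |: (eset A :|: eset B)).

Lemma glueC (V : finType) (a b : V) (A B : subgraph V) :
  glue a b A B = glue b a B A.
Proof. by rewrite /glue setUC [[set a; b]]setUC [eset A :|: _]setUC. Qed.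

Lemma contained_anti (V : finType) (H K : subgraph V) :
  contained H K -> contained K H -> H = K.
Proof.
case: H K => [HV HE] [KV KE] /andP[/= a b] /andP[/= c d].
by congr pair; apply/eqP; rewrite eqEsubset ?a ?b ?c ?d.
Qed.

Lemma contained_trans (V : finType) (H K L : subgraph V) :
  contained H K -> contained K L -> contained H L.
Proof.
case/andP=> a b /andP[c d].
by rewrite /contained (subset_trans a c) (subset_trans b d).
Qed.

Lemma contained_glue (V : finType) (a b : V) (A B : subgraph V) :
  contained A (glue a b A B).
Proof. by rewrite /contained /= subsetUl [_ |: _]setUCA subsetUl. Qed.

Lemma adj_sym (V : finType) (H : subgraph V) : symmetric (adj H).
Proof. by move=> u v; rewrite /adj /= setUC. Qed.

Lemma connected_from (V : finType) (H : subgraph V) (a : V) :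
  (forall v, v \in vset H -> connect (adj H) a v) -> connected H.
Proof.
move=> h; apply/forall_inP => u uH; apply/forall_inP => v vH.
apply: connect_trans (h v vH).
rewrite (sym_connect_sym (adj_sym H)); exact: h.
Qed.

Section Subtrees.

Variables (V : finType) (e : rel V).
Hypothesis sym_e : symmetric e.

Lemma in_edges u v : ([set u; v] \in edges e) = e u v.
Proof.
apply/idP/idP => [|euv]; last first.
  by rewrite inE; apply/existsP; exists u; apply/existsP; exists v; rewrite euv /=.
rewrite inE => /existsP[x /existsP[y /andP[exy /eqP/eq_set2]]].
by case=> -[-> ->] //; rewrite sym_e.
Qed.

Lemma subgraph_edge H u v :
  is_subgraph e H -> [set u; v] \in eset H -> [/\ e u v, u \in vset H & v \in vset H].
Proof.
case/andP=> /andP[_ /subsetP sE] /forall_inP sV uvH.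
have /subsetP uvV := sV _ uvH.
by split; [rewrite -in_edges; apply: sE | apply: uvV; rewrite set21 | apply: uvV; rewrite set22].
Qed.

Lemma subgraph_edgeP H f :
  is_subgraph e H -> f \in eset H -> exists u v, f = [set u; v].
Proof.
case/andP=> /andP[_ /subsetP sE] _ /sE.
by rewrite inE => /existsP[u /existsP[v /andP[_ /eqP->]]]; exists u, v.
Qed.

Lemma contained_restrict (S H : subgraph V) (X : {set V}) :
  is_subgraph e S -> vset S \subset X -> contained S H ->
  contained S (restrict X H).
Proof.
case/andP=> _ /forall_inP edgeS SX /andP[SV /subsetP SE].
rewrite /contained subsetI SV SX; apply/subsetP => f fS.
by rewrite inE SE // (subset_trans (edgeS f fS)).
Qed.

Lemma is_subgraphP H :
  (forall f, f \in eset H ->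
     exists u v, [/\ f = [set u; v], e u v, u \in vset H & v \in vset H]) ->
  is_subgraph e H.
Proof.
move=> h; apply/andP; split; last first.
  by apply/forall_inP => f /h[u [v [-> _ uH vH]]]; rewrite subUset !sub1set uH.
rewrite /contained subsetT /=; apply/subsetP => f /h[u [v [-> euv _ _]]].
by rewrite in_edges.
Qed.

Lemma subtree_connect H u v :
  is_subtree e H -> u \in vset H -> v \in vset H -> connect (adj H) u v.
Proof. by case/and3P=> _ _ /forall_inP h uH vH; apply: (forall_inP (h u uH)). Qed.

Lemma subtree_from H a :
  is_subgraph e H -> a \in vset H ->
  (forall v, v \in vset H -> connect (adj H) a v) -> is_subtree e H.
Proof.
move=> sH aH cH; apply/and3P; split=> //; last exact: connected_from cH.
by apply/set0Pn; exists a.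
Qed.

Lemma subtree_subgraph H : is_subtree e H -> is_subgraph e H.
Proof. by case/and3P. Qed.

Lemma subtree_single w : is_subtree e (single w).
Proof.
apply: (@subtree_from _ w); last 2 first.
- exact: set11.
- by move=> v /set1P->.
by apply: is_subgraphP => f; rewrite inE.
Qed.

Lemma del_edge_connect_sym f : connect_sym (del_edge e f).
Proof. by apply: sym_connect_sym => u v; rewrite /del_edge /= sym_e setUC. Qed.

(** * Cutting and joining along a bridge *)

Section Bridge.

Variables (a b : V).
Hypothesis conn_e : forall x y, connect e x y.

Lemma bridge_sym : is_bridge e a b -> is_bridge e b a.
Proof.
case/andP=> eab; rewrite /is_bridge sym_e eab setUC.
by rewrite [[set b; a]]setUC del_edge_connect_sym.
Qed.

Lemma side_edge u v :
  e u v -> [set u; v] != [set a; b] -> (u \in side e a b) = (v \in side e a b).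
Proof.
move=> euv uv; rewrite !inE; apply: same_connect_r.
  exact: del_edge_connect_sym.
by apply: connect1; rewrite /del_edge /= euv.
Qed.

Lemma side_root : a \in side e a b.
Proof. by rewrite inE connect0. Qed.

Hypothesis bridge_ab : is_bridge e a b.

Lemma side_other : b \notin side e a b.
Proof. by rewrite inE; case/andP: bridge_ab. Qed.

(** Disjointness is the bridge property; covering holds because the only edge
    not inside one of the two components has its ends at their roots. *)
Lemma sideC : side e b a = ~: side e a b.
Proof.
apply/setP => v; rewrite in_setC; apply/idP/idP.
  rewrite !inE => bv; case/andP: bridge_ab => _; apply: contra => av.
  apply: connect_trans av _.
  by rewrite del_edge_connect_sym [[set a; b]]setUC.
have : (v \in side e a b) || (v \in side e b a).
  apply: (@connect_invariant _ e (fun v => (v \in side e a b) || (v \in side e b a)) a) => //=.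
    move=> x y exy xs; have [/eq_set2[[_ ->]|[_ ->]]|ne] := eqVneq [set x; y] [set a; b].
    - by rewrite [b \in side e b a]inE connect0 orbT.
    - by rewrite side_root.
    rewrite -(side_edge exy ne).
    case/orP: xs => [->//|]; rewrite !inE => bx.
    apply/orP; right; apply: connect_trans bx _; apply: connect1.
    by rewrite /del_edge /= exy [[set b; a]]setUC.
  by rewrite side_root.
by case/orP=> ->.
Qed.

(** Walking inside [H] from [a], the only way to leave the side of [a] is the
    edge [ab]. *)
Lemma subtree_side H :
  is_subtree e H -> a \in vset H -> [set a; b] \notin eset H ->
  vset H \subset side e a b.
Proof.
move=> tH aH nab; apply/subsetP => v vH.
apply: (@connect_invariant _ (adj H) (mem (side e a b)) a) (subtree_connect tH aH vH) => /=.
  move=> x y /= xyH; have [exy _ _] := subgraph_edge (subtree_subgraph tH) xyH.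
  rewrite (side_edge exy) //; apply: contraNneq nab => <- //.
exact: side_root.
Qed.

Lemma subtree_avoid H :
  is_subtree e H -> a \in vset H -> b \notin vset H -> vset H \subset side e a b.
Proof.
move=> tH aH bH; apply: subtree_side => //; apply: contra bH => abH.
by case: (subgraph_edge (subtree_subgraph tH) abH).
Qed.

Lemma subtree_crossing H :
  is_subtree e H -> a \in vset H -> b \in vset H -> [set a; b] \in eset H.
Proof.
move=> tH aH bH; apply: contraT => nab.
by have := subsetP (subtree_side tH aH nab) b bH; rewrite (negPf side_other).
Qed.

(** A walk in [H] from [a] may leave the side of [a], but only through the
    bridge, hence it comes back at [a]: the excursion can be dropped. The proof
    carries this as an invariant of the walk, vacuous on the far side. *)
Lemma restrict_subtree H :
  is_subtree e H -> a \in vset H -> is_subtree e (restrict (side e a b) H).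
Proof.
move=> tH aH; have sH := subtree_subgraph tH.
apply: (@subtree_from _ a); last 2 first.
- by rewrite inE aH side_root.
- move=> v; rewrite inE => /andP[vH]; move: v {vH}(subtree_connect tH aH vH).
  set K := restrict _ H.
  move=> v av; apply/implyP; move: v av.
  apply: (@connect_invariant _ _ (fun v => (v \in side e a b) ==> connect (adj K) a v)).
    move=> x y; rewrite {1}/adj /= => xyH /implyP ax; apply/implyP => ys.
    have [exy xH yH] := subgraph_edge sH xyH.
    have [/eq_set2[[_ yb]|[_ ->]]|ne] := eqVneq [set x; y] [set a; b].
    - by rewrite yb (negPf side_other) in ys.
    - exact: connect0.
    have xs : x \in side e a b by rewrite (side_edge exy ne).
    apply: connect_trans (ax xs) _; apply: connect1.
    by rewrite /adj /= inE xyH subUset !sub1set xs ys.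
  by rewrite connect0 implybT.
apply: is_subgraphP => f; rewrite inE => /andP[fH fs].
have [u [v fE]] := subgraph_edgeP sH fH; rewrite fE in fH fs.
have [euv uH vH] := subgraph_edge sH fH.
move: fs; rewrite subUset !sub1set => /andP[us vs].
by exists u, v; rewrite !inE in us vs *; rewrite uH vH us vs.
Qed.

Lemma glue_subtree A B :
  is_subtree e A -> a \in vset A -> is_subtree e B -> b \in vset B ->
  is_subtree e (glue a b A B).
Proof.
move=> tA aA tB bB.
have sA := subtree_subgraph tA; have sB := subtree_subgraph tB.
have eab : e a b by case/andP: bridge_ab.
apply: (@subtree_from _ a); last 2 first.
- by rewrite inE aA.
- move=> v; rewrite inE => /orP[vA|vB].
    apply: (connect_sub _ (subtree_connect tA aA vA)) => x y; rewrite /adj /= => xy.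
    by apply: connect1; rewrite /adj /= !inE xy orbT.
  apply: (@connect_trans _ _ b); first by apply: connect1; rewrite /adj /= !inE eqxx.
  apply: (connect_sub _ (subtree_connect tB bB vB)) => x y; rewrite /adj /= => xy.
  by apply: connect1; rewrite /adj /= !inE xy !orbT.
apply: is_subgraphP => f; rewrite !inE => /or3P[/eqP->|fA|fB].
- by exists a, b; rewrite !inE aA bB orbT.
- have [u [v fE]] := subgraph_edgeP sA fA; rewrite fE in fA *.
  by have [euv uA vA] := subgraph_edge sA fA; exists u, v; rewrite !inE uA vA.
- have [u [v fE]] := subgraph_edgeP sB fB; rewrite fE in fB *.
  by have [euv uA vA] := subgraph_edge sB fB; exists u, v; rewrite !inE uA vA !orbT.
Qed.

Lemma glue_restrict H :
  is_subtree e H -> a \in vset H -> b \in vset H ->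
  glue a b (restrict (side e a b) H) (restrict (side e b a) H) = H.
Proof.
move=> tH aH bH; have sH := subtree_subgraph tH.
have abH := subtree_crossing tH aH bH.
rewrite sideC; case: H tH aH bH sH abH => HV HE tH aH bH sH abH.
congr pair; apply/setP => x; rewrite !inE /=; first by case: (x \in HV); case: (connect _ _ _).
have [->|ne] := eqVneq; first by rewrite abH.
case xH: (x \in HE) => //=.
have [u [v xE]] := subgraph_edgeP sH xH; rewrite xE in ne xH *.
have [euv _ _] := subgraph_edge sH xH.
rewrite !subUset !sub1set !in_setC -(side_edge euv ne).
by case: (u \in _).
Qed.

Lemma restrict_glue A B :
  is_subgraph e A -> is_subgraph e B ->
  vset A \subset side e a b -> vset B \subset side e b a ->
  restrict (side e a b) (glue a b A B) = A.
Proof.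
rewrite sideC; move=> sA sB sideA sideB.
case: A sA sideA => AV AE sA sideA.
congr pair; apply/setP => x.
  rewrite !inE; apply/andP/idP => /= [[/orP[//|xB] xs]|xA].
    by have := subsetP sideB x xB; rewrite !inE xs.
  by rewrite xA; have := subsetP sideA x xA; rewrite inE.
rewrite !inE /=; apply/andP/idP => [[/or3P[/eqP->||]]|xA].
- by rewrite subUset !sub1set (negPf side_other) andbF.
- by [].
- move=> xB; have [u [v xE]] := subgraph_edgeP sB xB; rewrite xE in xB *.
  have [_ /(subsetP sideB) us _] := subgraph_edge sB xB.
  by rewrite subUset !sub1set; rewrite in_setC in us; rewrite (negPf us).
split; first by rewrite xA orbT.
by case/andP: sA => _ /forall_inP/(_ x xA) /subset_trans; apply.
Qed.

End Bridge.

End Subtrees.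

(** A simple path from [a] to [b] avoiding the edge [ab] would close up with it
    into a cycle with more than two vertices. *)
Lemma tree_bridge (V : finType) (e : rel V) (a b : V) :
  is_tree e -> e a b -> is_bridge e a b.
Proof.
case=> sym_e irr_e _ _ acyclic eab; rewrite /is_bridge eab /=.
apply/negP => /connectP[p0 /shortenP[p pth uniq_p _] lastb].
have sub_path : path e a p by apply: sub_path pth => u v /andP[].
have /acyclic : ucycle e (a :: p).
  by rewrite /ucycle /= rcons_path sub_path -lastb sym_e eab; exact: uniq_p.
case: p pth lastb {uniq_p sub_path} => [|c [|d p]] //=.
- by move=> _ ab; rewrite ab irr_e in eab.
- by move=> + bc; rewrite /del_edge bc /= eqxx andbF.
Qed.

(** * The subtrees containing [S] and a neighbour [w] *)

Section Neighbour.

Variables (V : finType) (e : rel V) (S : subgraph V) (x w : V).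
Hypotheses (tree_e : is_tree e) (tS : is_subtree e S).
Hypotheses (xS : x \in vset S) (wS : w \notin vset S) (exw : e x w).

Lemma tree_sym : symmetric e.
Proof. by case: tree_e. Qed.

Lemma tree_connect u v : connect e u v.
Proof. by case: tree_e. Qed.

Lemma bridge_xw : is_bridge e x w.
Proof. exact: tree_bridge. Qed.

Lemma bridge_wx : is_bridge e w x.
Proof. by apply: bridge_sym; [exact: tree_sym | exact: bridge_xw]. Qed.

Local Hint Resolve tree_sym tree_connect bridge_xw bridge_wx : core.

Lemma base_side : vset S \subset side e x w.
Proof. exact: subtree_avoid. Qed.

(** Adding [w] adds a single edge: a second neighbour [y] of [w] in [S] would be
    on the side of [x], so the edge [yw] would bypass the bridge. *)
Lemma add_vertexE : add_vertex e S w = glue x w S (single w).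
Proof.
rewrite /add_vertex /glue /= setU0 setUC; congr pair.
rewrite setUC; congr (_ :|: _); apply/setP => f; rewrite inE.
apply/imsetP/eqP => [[y]|->]; last by exists x => //; rewrite inE xS.
rewrite inE => /andP[yS eyw] ->; apply/eqP; apply: contraT => ne.
have := subsetP base_side y yS.
by rewrite (side_edge tree_sym eyw ne) (negPf (side_other bridge_xw)).
Qed.

Lemma contained_add_vertex H :
  is_subtree e H ->
  contained (add_vertex e S w) H = contained S H && (w \in vset H).
Proof.
move=> tH; rewrite add_vertexE /contained /= !subUset sub1set sub0set andbT.
case SH: (vset S \subset vset H) => //=; case wH: (w \in vset H); last by rewrite andbF.
rewrite sub1set (subtree_crossing tree_sym bridge_xw tH) ?andbT //.
exact: subsetP SH x xS.
Qed.

Lemma crossingE H :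
  is_subtree e H && contained (add_vertex e S w) H =
  [&& is_subtree e H, contained S H & w \in vset H].
Proof. by case tH: (is_subtree e H); rewrite //= contained_add_vertex. Qed.

Lemma add_vertex_subtree : is_subtree e (add_vertex e S w).
Proof.
rewrite add_vertexE; apply: glue_subtree => //; last exact: set11.
exact: subtree_single.
Qed.

(** Also shows that the smallest subtree containing [S] and [w] exists, so the
    default value in [hull] is never taken. *)
Lemma hullE : hull e S w = add_vertex e S w.
Proof.
have tJ := add_vertex_subtree.
have: contained (add_vertex e S w) (add_vertex e S w) by rewrite /contained !subxx.
rewrite (contained_add_vertex tJ) => /andP[SJ wJ].
rewrite /hull; case: pickP => [J /and4P[tK SK wK /forallP minK]|]; last first.
  move/(_ (add_vertex e S w)); rewrite /is_smallest_subtree tJ SJ wJ /=.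
  move=> /negbT/forallPn[K]; rewrite negb_imply => /andP[/and3P[tK SK wK]].
  by rewrite (contained_add_vertex tK) SK wK.
apply: contained_anti => /=.
  by have := minK (add_vertex e S w); rewrite tJ SJ wJ.
by rewrite contained_add_vertex // SK.
Qed.

(** Avoiding [x] alone keeps a subtree through [w] on the far side of the bridge,
    away from the vertices and edges of all of [S + w] except [w]. *)
Lemma is_branchE B :
  is_branch e S w B = [&& is_subtree e B, w \in vset B & x \notin vset B].
Proof.
rewrite /is_branch hullE add_vertexE.
case tB: (is_subtree e B) => //=; case wB: (w \in vset B) => //=.
have xw : x != w by apply: contraNneq wS => <-.
have sB := subtree_subgraph tB.
apply/eqP/idP => [[/setP/(_ x)]|xB].
  by rewrite !inE xS (negPf xw) /= andbT => ->.
have B_side := subtree_avoid tree_sym tB wB xB.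
have dis u : u \in vset S -> u \notin vset B.
  move=> /(subsetP base_side); apply: contraL => /(subsetP B_side).
  by rewrite (sideC tree_sym tree_connect bridge_xw) in_setC.
congr pair; apply/setP => f.
  rewrite !inE; have [->|_] := eqVneq f w; first by rewrite wB orbT.
  by rewrite orbF; apply/negP => /andP[fB /dis]; rewrite fB.
rewrite !inE orbF; apply/negP => /andP[fB /orP[/eqP fE|fS]].
  by rewrite fE in fB; case: (subgraph_edge tree_sym sB fB) => _; rewrite (negPf xB).
have [u [v fE]] := subgraph_edgeP sB fB; rewrite fE in fB fS.
have [_ uB _] := subgraph_edge tree_sym sB fB.
have [_ uS _] := subgraph_edge tree_sym (subtree_subgraph tS) fS.
by have := dis u uS; rewrite uB.
Qed.

Definition avoiding (A : subgraph V) : bool :=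
  [&& is_subtree e A, contained S A & w \notin vset A].

Definition avoiding_count : nat := #|[set A | avoiding A]|.

Definition avoiding_order : nat := \sum_(A | avoiding A) subgraph_order A.

(** Reindexing along the bijection between the subtrees [H] containing [S] and
    [w] and the pairs formed by a subtree avoiding [w] and a branch. *)
Lemma sum_crossing (F : subgraph V -> nat) :
  \sum_(H | [&& is_subtree e H, contained S H & w \in vset H]) F H =
  \sum_(A | avoiding A) \sum_(B | is_branch e S w B) F (glue x w A B).
Proof.
pose h (p : subgraph V * subgraph V) := glue x w p.1 p.2.
pose h' H := (restrict (side e x w) H, restrict (side e w x) H).
rewrite pair_big /= (reindex_onto h h') /=; last first.
  move=> H /and3P[tH /andP[/subsetP SH _] wH].
  by apply: glue_restrict => //; apply: SH.
apply: eq_bigl => -[A B] /=; rewrite is_branchE /avoiding.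
apply/idP/idP.
  case/andP=> /and3P[tH SH wH] /eqP[EA EB].
  have xH : x \in vset (h (A, B)) by case/andP: SH => /subsetP SH _; apply: SH.
  have tA : is_subtree e A by rewrite -EA; apply: restrict_subtree.
  have tB : is_subtree e B by rewrite -EB; apply: restrict_subtree.
  have SA : contained S A.
    by rewrite -EA; apply: contained_restrict SH;
       [exact: subtree_subgraph tS | exact: base_side].
  rewrite tA SA tB -EA -EB ![_ \in vset (restrict _ _)]in_setI wH side_root.
  by rewrite (negPf (side_other bridge_xw)) (negPf (side_other bridge_wx)) !andbF.
case/andP=> /and3P[tA SA wA] /and3P[tB wB xB].
have xA : x \in vset A by case/andP: SA => /subsetP SA _; apply: SA.
have A_side := subtree_avoid tree_sym tA xA wA.
have B_side := subtree_avoid tree_sym tB wB xB.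
have sA := subtree_subgraph tA; have sB := subtree_subgraph tB.
rewrite glue_subtree //= (contained_trans SA) ?contained_glue //.
rewrite [w \in _]in_setU wB orbT /=; apply/eqP.
by congr pair; rewrite ?restrict_glue // /h glueC restrict_glue.
Qed.

Lemma order_glue A B :
  is_subtree e A -> contained S A -> w \notin vset A -> is_branch e S w B ->
  subgraph_order (glue x w A B) = subgraph_order A + subgraph_order B.
Proof.
move=> tA SA wA; rewrite is_branchE => /and3P[tB wB xB].
have xA : x \in vset A by case/andP: SA => /subsetP SA _; apply: SA.
apply/eqP; rewrite /subgraph_order (leq_card_setU _ _).2.
rewrite disjoints_subset; apply: subset_trans (subtree_avoid tree_sym tA xA wA) _.
rewrite -(setCK (side e x w)) setCS -(sideC tree_sym tree_connect bridge_xw).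
exact: subtree_avoid.
Qed.

Lemma count_add_vertex : N e (add_vertex e S w) = avoiding_count * N_at e w S.
Proof.
rewrite /N -sum1dep_card -sum_nat_const.
under eq_bigl => H do rewrite crossingE.
rewrite sum_crossing; apply: eq_big => [A|A _]; first by rewrite inE.
by rewrite sum1dep_card.
Qed.

Lemma order_add_vertex :
  R e (add_vertex e S w) = avoiding_order * N_at e w S + avoiding_count * R_at e w S.
Proof.
rewrite /R; under eq_bigl => H do rewrite crossingE.
rewrite sum_crossing big_distrl -sum_nat_const /=.
rewrite [X in _ + X](eq_bigl avoiding) => [|A]; last by rewrite inE.
rewrite -big_split; apply: eq_bigr => A /and3P[tA SA wA].
under eq_bigr => B brB do rewrite order_glue //.
by rewrite big_split /= sum_nat_cond_const mulnC.
Qed.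

Lemma split_at_neighbour (F : subgraph V -> nat) :
  \sum_(H | is_subtree e H && contained S H) F H =
  \sum_(A | avoiding A) F A +
  \sum_(H | is_subtree e H && contained (add_vertex e S w) H) F H.
Proof.
rewrite (bigID (fun H => w \notin vset H)) /=; congr (_ + _).
  by apply: eq_bigl => H; rewrite -andbA.
by apply: eq_bigl => H; rewrite negbK -andbA crossingE.
Qed.

Lemma avoiding_count_gt0 : 0 < avoiding_count.
Proof.
by apply/card_gt0P; exists S; rewrite inE /avoiding tS wS /contained !subxx.
Qed.

Lemma branch_count_gt0 : 0 < N_at e w S.
Proof.
apply/card_gt0P; exists (single w); rewrite inE is_branchE subtree_single //=.
by rewrite set11 inE; apply: contraNneq wS => <-.
Qed.

Lemma neighbour_mean :
  (mu e (add_vertex e S w) =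
     mu e S + (R_at e w S)%:R / ((N_at e w S)%:R * (1 + (N_at e w S)%:R)))%R.
Proof.
have countS : N e S = avoiding_count + avoiding_count * N_at e w S.
  by rewrite -count_add_vertex /N -!sum1dep_card
     split_at_neighbour /avoiding_count sum1dep_card.
have orderS : R e S = avoiding_order + R e (add_vertex e S w).
  exact: split_at_neighbour.
rewrite /mu orderS countS count_add_vertex order_add_vertex !(natrD, natrM).
have branch_gt0 := branch_count_gt0; have avoiding_gt0 := avoiding_count_gt0.
field.
by rewrite nat1r -!natrM -!natrD !pnatr_eq0 -!lt0n addn_gt0 avoiding_gt0 branch_gt0.
Qed.

End Neighbour.

Theorem lemma3p1 (V : finType) (e : rel V) (S : subgraph V) (w : V)
    (tree_e : is_tree e) (subtree_S : is_subtree e S)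
    (proper_S : S != whole e) (nbr_w : is_neighbour e S w) :
  (mu e (add_vertex e S w) =
     mu e S + (R_at e w S)%:R / ((N_at e w S)%:R * (1 + (N_at e w S)%:R)))%R.
Proof.
case/andP: nbr_w => wS /exists_inP[x xS exw].
exact: (neighbour_mean tree_e subtree_S xS wS exw).
Qed.
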